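(* Let $q\in\mathbb{C}[x_1,\dotsc,x_d]$ be a non-zero polynomial, let $J=\langle q\rangle$ be the ideal generated by $q$, and let $L=q^{\wedge}$ be the leading form of $q$. Then $\ker\overline{L}(\mathbf{D})\cap J=\{0\}$, and $\mathbb{C}[x_1,\dotsc,x_d]=\ker\overline{L}(\mathbf{D})\oplus J$ (direct sum of vector spaces).
   Context: If $q=\sum_{|\alpha|\le n}a_\alpha\mathbf{x}^\alpha$ has degree $n$, its leading form is $q^{\wedge}=\sum_{|\alpha|=n}a_\alpha\mathbf{x}^\alpha$. For a polynomial $L=\sum_\alpha b_\alpha\mathbf{x}^\alpha$, $\overline{L}=\sum_\alpha\overline{b_\alpha}\,\mathbf{x}^\alpha$ denotes the complex conjugate polynomial (coefficients conjugated). $\overline{L}(\mathbf{D})$ is the differential operator on $\mathbb{C}[x_1,\dotsc,x_d]$ obtained by formally replacing each variable $x_j$ in $\overline{L}$ with the partial derivative $D_j=\partial/\partial x_j$; $\ker\overline{L}(\mathbf{D})=\{f\in\mathbb{C}[x_1,\dotsc,x_d]:\overline{L}(\mathbf{D})f=0\}$. *)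

(* Defs.v *)
From HB Require Import structures.
From mathcomp Require Import all_boot all_order all_algebra.
From mathcomp Require Import boolp classical_sets reals.
From mathcomp Require Import complex mpoly.

Set Implicit Arguments.
Unset Strict Implicit.
Unset Printing Implicit Defensive.

Import GRing.Theory.

Local Open Scope ring_scope.
Local Open Scope classical_set_scope.

(* [pihomog mdeg n q] is the degree-[n] homogeneous component of [q], and
   [(msize q).-1] is the total degree of [q] when [q != 0]. *)
Definition leading_form (K : nzRingType) (d : nat) (q : {mpoly K[d]}) :
    {mpoly K[d]} :=
  pihomog mdeg (msize q).-1 q.

Definition conj_mpoly (R : realType) (d : nat) (p : {mpoly R[i][d]}) :
    {mpoly R[i][d]} :=
  map_mpoly (@conjc R) p.

(* [f^`M[m]] is the iterated partial derivative [D^m f]. *)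
Definition diff_op (K : comNzRingType) (d : nat) (p f : {mpoly K[d]}) :
    {mpoly K[d]} :=
  \sum_(m <- msupp p) p@_m *: f^`M[m].

Definition diff_ker (K : comNzRingType) (d : nat) (p : {mpoly K[d]}) :
    set {mpoly K[d]} :=
  [set f | diff_op p f = 0].

Definition principal_ideal (A : comNzRingType) (a : A) : set A :=
  [set x | exists g : A, x = g * a].

Definition direct_sum_decomposition (K : nzRingType) (V : lmodType K)
    (U W : set V) : Prop :=
  [/\ GRing.submod_closed (mem U), GRing.submod_closed (mem W) &
      forall v : V, exists! uw : V * V, [/\ U uw.1, W uw.2 & v = uw.1 + uw.2]].

(* Main.v *)
Require Import Defs.
From mathcomp Require Import all_boot all_order all_algebra.
From mathcomp Require Import boolp classical_sets reals.
From mathcomp Require Import complex mpoly.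
From mathcomp Require Import ssrcomplements.
From HB Require Import structures.

(* Put T = conj(L)(D).  If T (g q) = 0, then, writing h for the leading form
   of g q, multiplicativity of p |-> p(D) gives conj(h)(D) (g q) = 0, whose
   constant term is the Fischer norm sum_m m! |h_m|^2; hence g = 0.  Since T
   lowers the degree by deg q, the map g |-> T (g q) is an injective
   endomorphism of each finite-dimensional space of polynomials of bounded
   degree, hence surjective: T f = T (g q) for some g, and f - g q is in the
   kernel of T. *)

Import GRing.Theory Num.Theory.

Local Open Scope ring_scope.
Local Open Scope classical_set_scope.

(** * Degree bounds; [msize] is the degree plus one, and 0 for the zero polynomial *)

Lemma mcoeff_msize_le (K : nzRingType) (d : nat) (p : {mpoly K[d]}) m :
  (msize p <= mdeg m)%N -> p@_m = 0.
Proof. by move=> h; apply/memN_msupp_eq0/msize_mdeg_ge. Qed.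

Lemma msize_leP (K : nzRingType) (d k : nat) (p : {mpoly K[d]}) :
  (forall m, (k <= mdeg m)%N -> p@_m = 0) -> (msize p <= k)%N.
Proof.
move=> hp; rewrite msizeE big_seq; apply/bigmax_leqP_seq => m _ hm.
by rewrite ltnNge; apply/negP => /hp/eqP; rewrite mcoeff_eq0 hm.
Qed.

Lemma msizeM_le_pred (K : idomainType) (d : nat) (p q : {mpoly K[d]}) :
  (msize (p * q) <= (msize p + msize q).-1)%N.
Proof.
have [->|p0] := eqVneq p 0; first by rewrite mul0r msize0.
have [->|q0] := eqVneq q 0; first by rewrite mulr0 msize0.
by rewrite msizeM.
Qed.

Lemma msize_dhomog_le (K : nzRingType) (d n : nat) (p : {mpoly K[d]}) :
  p \is n.-homog -> (msize p <= n.+1)%N.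
Proof.
move=> hp; apply: msize_leP => m nm.
by apply: (dhomog_nemf_coeff hp); rewrite gtn_eqF.
Qed.

(** * Differential operators with constant coefficients *)

Section DiffOp.
Variables (K : comNzRingType) (d : nat).
Implicit Types p r f : {mpoly K[d]}.

Lemma diff_op_linear p : linear (diff_op p).
Proof.
move=> c f g; rewrite /diff_op scaler_sumr -big_split /=.
apply/eq_bigr => m _.
by rewrite mderivmD mderivmZ scalerDr !scalerA mulrC.
Qed.

HB.instance Definition _ p :=
  GRing.isLinear.Build K {mpoly K[d]} {mpoly K[d]} *:%R (diff_op p)
    (diff_op_linear p).

(** Makes the index set independent of the support of [p], so that operators of different
    polynomials can be added term by term. *)
Lemma diff_opwE k p f : (msize p <= k)%N ->
  diff_op p f = \sum_(m : 'X_{1..d < k}) p@_m *: f^`M[m].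
Proof.
move=> lt_pk; pose I : subFinType _ := 'X_{1..d < k}.
rewrite /diff_op (big_mksub I) //=; first last.
- by move=> x /msize_mdeg_lt /leq_trans; apply.
- by rewrite msupp_uniq.
by rewrite big_rmcond //= => i; move/memN_msupp_eq0 ->; rewrite scale0r.
Qed.

(** Both sides are linear in [p] and in [r], which reduces the claim to monomials, where it is the
    composition rule for iterated partial derivatives. *)
Lemma diff_opM p r f : diff_op (p * r) f = diff_op p (diff_op r f).
Proof.
have lin_l : forall f, linear (fun s => diff_op s f).
  move=> {}f c s t; pose k := maxn (msize s) (msize t).
  have ks : (msize s <= k)%N by rewrite leq_maxl.
  have kt : (msize t <= k)%N by rewrite leq_maxr.
  have kcst : (msize (c *: s + t) <= k)%N.
    apply: (leq_trans (msizeD_le _ _)); rewrite geq_max kt andbT.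
    exact: leq_trans (msizeZ_le _ _) ks.
  rewrite !(diff_opwE k) // scaler_sumr -big_split /=.
  by apply/eq_bigr => m _; rewrite mcoeffD mcoeffZ scalerDl scalerA.
pose D g : {linear {mpoly K[d]} -> {mpoly K[d]}} :=
  HB.pack (fun s => diff_op s g)
    (GRing.isLinear.Build K {mpoly K[d]} {mpoly K[d]} *:%R _ (lin_l g)).
have DX m g : diff_op 'X_[m] g = g^`M[m].
  by rewrite /diff_op msuppX big_seq1 mcoeffX eqxx scale1r.
rewrite -[LHS]/(D f (p * r)) -[RHS]/(D (diff_op r f) p).
rewrite {1}[p]mpolyE [in RHS](mpolyE p) mulr_suml !linear_sum /=.
apply/eq_bigr => a _.
rewrite -mpoly_scaleAl -[LHS]/(D f _) -[RHS]/(D _ _) !linearZ /=; congr (_ *: _).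
rewrite DX -[LHS]/(D f _) {1}[r]mpolyE mulr_sumr linear_sum /=.
rewrite [X in X^`M[a]]/diff_op [RHS](linear_sum (mderivm a)).
apply/eq_bigr => b _.
rewrite -scalerAr -[LHS]/(D f _) linearZ /= mderivmZ.
by rewrite -mpolyXD DX addmC mderivmDm.
Qed.

Lemma msize_diff_op_dhomog n k p f : p \is n.-homog ->
  (msize f <= n + k)%N -> (msize (diff_op p f) <= k)%N.
Proof.
move=> /dhomogP hp hf; apply: msize_leP => m km.
rewrite /diff_op linear_sum /= big_seq big1 // => a /hp da.
rewrite mcoeffZ mcoeff_mderivm (mcoeff_msize_le _ _ f) ?mul0rn ?mulr0 //.
by rewrite mdegD (leq_trans hf) // [mdeg a]da leq_add2l.
Qed.

End DiffOp.

(** * Homogeneous components and leading forms *)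

Section LeadingForm.
Variables (K : nzRingType) (d : nat).
Implicit Types p : {mpoly K[d]}.

Lemma mcoeff_pihomog n p m :
  (pihomog mdeg n p)@_m = if mdeg m == n then p@_m else 0.
Proof.
rewrite (pihomogwE _ _ (leqnn (msize p))) linear_sum /=.
rewrite (eq_bigr (fun m' : 'X_{1..d < msize p} =>
  p@_m' * (m' == m :> 'X_{1..d})%:R)); last first.
  by move=> m' _; rewrite mcoeffZ mcoeffX.
case: (ltnP (mdeg m) (msize p)) => hm; last first.
  rewrite mcoeff_msize_le // if_same big1 // => m' _.
  case: eqP => [e|]; last by rewrite mulr0.
  by have := bmdeg m'; rewrite e ltnNge hm.
rewrite big_mkcond (bigD1 (BMultinom hm)) //= eqxx mulr1 big1 ?addr0 // => m' ne.
case: ifP => // _; case: eqP => [e|]; last by rewrite mulr0.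
by case/eqP: ne; apply/val_inj.
Qed.

Lemma leading_form_dhomog p : leading_form p \is ((msize p).-1).-homog.
Proof. exact: pihomogP. Qed.

(** The monomial order refines the degree, so the coefficient at [mlead p] survives in the leading
    form. *)
Lemma leading_form_neq0 p : p != 0 -> leading_form p != 0.
Proof.
move=> p0; apply/eqP => /(congr1 (mcoeff (mlead p))).
rewrite mcoeff0 mcoeff_pihomog -mlead_deg // eqxx.
by move/eqP; rewrite mleadc_eq0 (negPf p0).
Qed.

Lemma msize_sub_leading_form p : (msize (p - leading_form p) <= (msize p).-1)%N.
Proof.
apply: msize_leP => m; rewrite leq_eqVlt mcoeffB mcoeff_pihomog.
case/orP => [/eqP <-|lt]; first by rewrite eqxx subrr.
rewrite gtn_eqF // subr0 mcoeff_msize_le //.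
by case: (msize p) lt.
Qed.

End LeadingForm.

(** The polynomials with [msize] at most [k] form a finite-dimensional space stable under [phi]. In
    its monomial basis [phi] is a square matrix with trivial kernel, hence invertible. *)
Lemma linear_inj_surj_msize (K : fieldType) (d k : nat)
    (phi : {linear {mpoly K[d]} -> {mpoly K[d]}}) :
  (forall p, msize p <= k -> msize (phi p) <= k)%N ->
  (forall p, phi p = 0 -> p = 0) ->
  forall f, (msize f <= k)%N -> exists g, phi g = f.
Proof.
move=> phik phi_inj f fk.
pose N := #|{: 'X_{1..d < k}}|.
pose mon (i : 'I_N) : 'X_{1..d} := bmnm (enum_val i).
pose P (v : 'rV[K]_N) := \sum_i v 0 i *: 'X_[mon i] : {mpoly K[d]}.
have P_coef (v : 'rV[K]_N) j : (P v)@_(mon j) = v 0 j.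
  rewrite linear_sum (bigD1 j) //= mcoeffZ mcoeffX eqxx mulr1 big1 ?addr0 //.
  move=> i ij; rewrite mcoeffZ mcoeffX; case: eqP => [e|]; last by rewrite mulr0.
  by case/eqP: ij; apply/enum_val_inj/val_inj.
have eqP_coef g h : (msize g <= k)%N -> (msize h <= k)%N ->
    (forall j, g@_(mon j) = h@_(mon j)) -> g = h.
  move=> gk hk gh; apply/mpolyP => m; case: (ltnP (mdeg m) k) => mk.
    by have := gh (enum_rank (BMultinom mk)); rewrite /mon enum_rankK.
  by rewrite !mcoeff_msize_le // (leq_trans _ mk).
have Pk v : (msize (P v) <= k)%N.
  apply: msize_leP => m km; rewrite linear_sum big1 //= => i _.
  rewrite mcoeffZ mcoeffX; case: eqP => [e|]; last by rewrite mulr0.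
  by have := bmdeg (enum_val i); rewrite -/(mon i) e ltnNge km.
(* Row [i] holds the coordinates of the image of the [i]-th monomial, so [phi] acts on row vectors
   by right multiplication. *)
pose A : 'M[K]_N := \matrix_(i, j) (phi 'X_[mon i])@_(mon j).
have mulA v j : (v *m A) 0 j = (phi (P v))@_(mon j).
  rewrite mxE !linear_sum /=; apply/eq_bigr => i _.
  by rewrite mxE linearZ /= mcoeffZ.
have A_unit : A \in unitmx.
  rewrite -row_free_unit; apply: inj_row_free => v vA0.
  apply/rowP => j; rewrite mxE -P_coef.
  rewrite (phi_inj (P v)) ?mcoeff0 //; apply: eqP_coef.
  - exact/phik/Pk.
  - by rewrite msize0.
  - by move=> i; rewrite -mulA vA0 mxE mcoeff0.
exists (P ((\row_j f@_(mon j)) *m invmx A)).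
apply: eqP_coef => // [|j]; first exact/phik/Pk.
by rewrite -mulA mulmxKV // mxE.
Qed.

(** * The Fischer inner product and injectivity of g |-> T (g q) *)

Section Fischer.
Variables (R : realType) (d : nat).
Implicit Types p q f g h : {mpoly R[i][d]}.

Lemma conj_mpolyM p q : conj_mpoly (p * q) = conj_mpoly p * conj_mpoly q.
Proof. exact: rmorphM. Qed.

Lemma mem_msupp_conj p m : (m \in msupp (conj_mpoly p)) = (m \in msupp p).
Proof. by apply/negb_inj; rewrite -!mcoeff_eq0 mcoeff_map_mpoly conjc_eq0. Qed.

(* The constant term of [conj_mpoly h (D) f] is the Fischer inner product
   [\sum_m m! * f@_m * (h@_m)^*]. *)
Lemma fischer_eq0 h f : {in msupp h, forall m, f@_m = h@_m} ->
  (diff_op (conj_mpoly h) f)@_0 = 0 -> h = 0.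
Proof.
move=> fh; rewrite /diff_op linear_sum /= => sum0.
(* This is the multi-index factorial m!, as the falling factorial [x ^_ x] is x!. *)
pose c (m : 'X_{1..d}) := (\prod_(i < d) (m + 0)%MM i ^_ m i)%N.
have term m : m \in msupp h ->
    ((conj_mpoly h)@_m *: f^`M[m])@_0 = `|h@_m| ^+ 2 *+ c m.
  move=> mh; rewrite mcoeffZ mcoeff_mderivm addm0 fh //.
  rewrite mcoeff_map_mpoly mulrnAr sqr_normc mulrC.
  by rewrite /c addm0.
move/eqP: sum0; rewrite big_seq.
rewrite (eq_bigr (fun m => `|h@_m| ^+ 2 *+ c m)) => [|m]; last first.
  by rewrite mem_msupp_conj => /term.
(* A vanishing sum of nonnegative terms has only zero terms; as m! > 0, no monomial can lie in the
   support of [h]. *)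
rewrite psumr_eq0 => [|m _]; last by rewrite mulrn_wge0 // exprn_ge0.
move=> /allP all0; apply/mpolyP => m; rewrite mcoeff0; apply/eqP.
rewrite mcoeff_eq0; apply/negP => mh.
have mch : m \in msupp (conj_mpoly h) by rewrite mem_msupp_conj.
have := all0 m mch; rewrite mch /= mulrn_eq0 expf_eq0 normr_eq0 /= mcoeff_eq0 mh.
rewrite orbF => /eqP c0; have : (0 < c m)%N.
  by rewrite prodn_gt0 // => i; rewrite addm0 ffact_gt0.
by rewrite c0.
Qed.

Lemma conj_mpoly_dhomog n p : p \is n.-homog -> conj_mpoly p \is n.-homog.
Proof.
by move=> /dhomogP hp; apply/dhomogP => m; rewrite mem_msupp_conj => /hp.
Qed.

Lemma diff_op_conj_leading_form_inj q g : q != 0 ->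
  diff_op (conj_mpoly (leading_form q)) (g * q) = 0 -> g = 0.
Proof.
move=> q0 T0; apply/eqP; case: (eqVneq g 0) => // g0.
set L := leading_form q in T0; set G := leading_form g.
have h0 : G * L != 0 by rewrite mulf_neq0 ?leading_form_neq0.
(* The operator of the conjugate of [G * L] factors through that of [L], which kills [g * q]. It
   remains to see that [g * q] and [G * L] agree on the support of [G * L]. *)
case/eqP: h0; apply: (fischer_eq0 _ (g * q)); last first.
  by rewrite conj_mpolyM diff_opM T0 linear0 mcoeff0.
move=> m; have := dhomogM (leading_form_dhomog _ _ g) (leading_form_dhomog _ _ q).
move=> /dhomogP hGL /hGL dm.
apply/eqP; rewrite -subr_eq0 -mcoeffB.
(* Each summand on the right has degree below deg g + deg q, the degree of every monomial [m] of
   [G * L]. *)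
have -> : g * q - G * L = G * (q - L) + (g - G) * q.
  by rewrite mulrBr mulrBl [RHS]addrC addrA subrK.
have Gs := msize_dhomog_le _ _ _ _ (leading_form_dhomog _ _ g).
have qs : msize q = (msize q).-1.+1 by rewrite -mpolySpred.
have gLs := msize_sub_leading_form _ _ g.
have qLs := msize_sub_leading_form _ _ q.
rewrite mcoeffD !mcoeff_msize_le ?addr0 // [mdeg m]dm;
  apply: (leq_trans (msizeM_le_pred _ _ _ _)).
  by rewrite qs addnS /= leq_add2r.
by rewrite -subn1 leq_subLR add1n -addSn leq_add.
Qed.

End Fischer.

Theorem theorem3p4 (R : realType) (d : nat) (q : {mpoly R[i][d]})
    (q_neq0 : q != 0) :
  let L := leading_form q in
  let J := principal_ideal q in
  diff_ker (conj_mpoly L) `&` J = [set 0] /\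
  direct_sum_decomposition (diff_ker (conj_mpoly L)) J.
Proof.
move=> L J; pose n := (msize q).-1; pose T := diff_op (conj_mpoly L).
have T_inj g : T (g * q) = 0 -> g = 0.
  exact: diff_op_conj_leading_form_inj.
have Tk k f : (msize f <= n + k)%N -> (msize (T f) <= k)%N.
  exact/msize_diff_op_dhomog/conj_mpoly_dhomog/leading_form_dhomog.
have kerJ f : T f = 0 -> J f -> f = 0.
  by move=> Tf [g fE]; move: Tf; rewrite fE => /T_inj ->; rewrite mul0r.
have sub_ker : GRing.submod_closed (mem (diff_ker (conj_mpoly L))).
  split=> [|c f g]; rewrite !inE /diff_ker /= -/T; first exact: linear0.
  by move=> f0 g0; rewrite /T linearP /= -/T f0 g0 scaler0 addr0.
have sub_J : GRing.submod_closed (mem J).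
  split=> [|c f g]; rewrite !inE; first by exists 0; rewrite mul0r.
  by case=> a -> [b ->]; exists (c *: a + b); rewrite mulrDl scalerAl.
split.
  apply/seteqP; split=> [f [/= ? ?]|f /= ->]; first exact: kerJ.
  by split; [exact: linear0 | exists 0; rewrite mul0r].
split=> // f.
have phi_lin : linear (fun g => T (g * q)).
  by move=> c a b; rewrite mulrDl -scalerAl /T linearP.
pose phi : {linear {mpoly R[i][d]} -> {mpoly R[i][d]}} :=
  HB.pack (fun g => T (g * q))
    (GRing.isLinear.Build _ {mpoly R[i][d]} {mpoly R[i][d]} *:%R _ phi_lin).
have [g gE] : exists g, phi g = T f.
  (* Multiplication by [q] raises the degree by [n] and [T] lowers it by [n], so [phi] preserves
     every degree bound. The bound [msize f] also covers [T f]. *)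
  apply: (linear_inj_surj_msize _ _ (msize f)) => // [p pk|].
    apply: Tk; apply: (leq_trans (msizeM_le_pred _ _ _ _)).
    by rewrite (mpolySpred mdeg q_neq0) addnS addnC leq_add2l.
  by apply: Tk; rewrite leq_addl.
exists (f - g * q, g * q); split=> /=.
  split; [|by exists g|by rewrite subrK].
  by rewrite /diff_ker /= -/T /T linearB /= -/T -[T (g * q)]/(phi g) gE subrr.
(* Uniqueness: [w - g * q] lies in [J] and equals [(f - g * q) - u], a difference of kernel
   elements, so the trivial intersection makes it zero. *)
move=> [u w] /= [Tu Jw fE].
have Jd : J (w - g * q).
  by case: Jw => a ->; exists (a - g); rewrite mulrBl.
suff /kerJ/(_ Jd)/eqP : T (w - g * q) = 0.
  by rewrite subr_eq0 => /eqP wE; rewrite fE wE addrK.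
have -> : w - g * q = (f - g * q) - u by rewrite fE [u + w]addrC addrAC addrK.
rewrite /T !linearB /= -/T -[T (g * q)]/(phi g) gE subrr sub0r.
by rewrite [T u]Tu oppr0.
Qed.
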